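(* Let $f,g_1,\dots,g_m\in\mathbb{R}[x_1,\dots,x_n]$ define the polynomial optimization problem $\rho^*=\inf\{f(\mathbf{x}):g_1(\mathbf{x})\ge0,\dots,g_m(\mathbf{x})\ge0\}$, and let $d\ge d_{\min}$. Assume that the chordal extension used in the construction of the graphs $G_{d,l,j}^{(k)}=(F_{d,l,j}^{(k)})'$ is the maximal chordal extension (the one completing every connected component to a complete graph). Then the sequence $(\rho_d^{(k)})_{k\ge1}$ of optimal values of the CS-TSSOS relaxations $(\mathrm{Q}^{\mathrm{cs\text{-}ts}}_{d,k})$ converges in finitely many steps to the optimal value $\rho_d$ of the correlative-sparsity relaxation $(\mathrm{Q}^{\mathrm{cs}}_d)$; that is, there is $k_0$ such that $\rho_d^{(k)}=\rho_d$ for all $k\ge k_0$.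
   Context: Notation. $\mathbb{N}=\{0,1,2,\dots\}$, $[m]=\{1,\dots,m\}$, $\mathbb{N}^n_d=\{\boldsymbol\alpha\in\mathbb{N}^n:\sum_i\alpha_i\le d\}$, $(2\mathbb{N})^n=\{2\boldsymbol\alpha:\boldsymbol\alpha\in\mathbb{N}^n\}$. For a polynomial $h=\sum h_{\boldsymbol\alpha}\mathbf{x}^{\boldsymbol\alpha}$, $\mathrm{supp}(h)=\{\boldsymbol\alpha:h_{\boldsymbol\alpha}\ne0\}$; for an exponent $\boldsymbol\alpha$, $\mathrm{supp}(\boldsymbol\alpha)=\{i:\alpha_i\neq0\}$; $\mathrm{var}(h)$ is the set of (indices of) variables occurring in $h$. Sums of sets of exponents are Minkowski sums. Set $g_0=1$, $d_0=0$, $d_j=\lceil\deg(g_j)/2\rceil$, $d_{\min}=\max\{\lceil\deg(f)/2\rceil,d_1,\dots,d_m\}$. Graphs. Graphs are undirected without loops. $G\subseteq H$ means $V(G)\subseteq V(H)$ and $E(G)\subseteq E(H)$. A chordal extension of $G$ is a chordal graph on the same nodes containing $G$; the maximal chordal extension makes every connected component of $G$ a complete subgraph. $G'$ denotes the chosen chordal extension of $G$. For $G$ with $V(G)\subseteq\mathbb{N}^n$, $\mathrm{supp}(G)=\{\boldsymbol\beta+\boldsymbol\gamma:\boldsymbol\beta=\boldsymbol\gamma\in V(G)\text{ or }\{\boldsymbol\beta,\boldsymbol\gamma\}\in E(G)\}$. $B_G$ is the adjacency matrix with ones on the diagonal; $\circ$ is the Hadamard product; $\mathbf{S}_+^r$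 is the cone of $r\times r$ PSD matrices; $\Pi_G(Q)$ keeps the diagonal entries and the entries of $Q$ indexed by edges of $G$ and sets the others to zero; $\Pi_G(\mathbf{S}_+^{|V|})=\{\Pi_G(Q):Q\in\mathbf{S}_+^{|V|}\}$. Correlative sparsity. The csp graph has nodes $[n]$ and an edge $\{i,j\}$, $i\ne j$, if some $\boldsymbol\alpha\in\mathrm{supp}(f)$ has $\alpha_i,\alpha_j>0$, or $x_i,x_j\in\mathrm{var}(g_k)$ for some $k\in[m]$. Fix a chordal extension of it with maximal cliques $I_1,\dots,I_p$, $n_l=|I_l|$, and pairwise disjoint $J_1,\dots,J_p$ with union $[m]$ such that $\mathrm{var}(g_j)\subseteq I_l$ for $j\in J_l$. $\mathbb{N}^{n_l}$ is identified with $\{\boldsymbol\alpha\in\mathbb{N}^n:\mathrm{supp}(\boldsymbol\alpha)\subseteq I_l\}$, and $\mathbb{N}^{n_l}_d$ accordingly. Moment data. For a real sequence $\mathbf{y}=(y_{\boldsymbol\alpha})_{\boldsymbol\alpha\in\mathbb{N}^n}$, $L_{\mathbf{y}}(\sum h_{\boldsymbol\alpha}\mathbf{x}^{\boldsymbol\alpha})=\sum h_{\boldsymbol\alpha}y_{\boldsymbol\alpha}$. For $g\in\mathbb{R}[\mathbf{x}(I_l)]$ (polynomials in the variables $x_i$, $i\in I_l$), $M_d(g\mathbf{y},I_l)$ is the matrix indexed by $\mathbb{N}^{n_l}_d$ with entries $L_{\mathbf{y}}(g\,\mathbf{x}^{\boldsymbol\beta}\mathbf{x}^{\boldsymbol\gamma})$,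 and $M_d(\mathbf{y},I_l)=M_d(1\cdot\mathbf{y},I_l)$. The relaxation $(\mathrm{Q}^{\mathrm{cs}}_d)$ is: $\rho_d=\inf L_{\mathbf{y}}(f)$ s.t. $M_d(\mathbf{y},I_l)\succeq0$ and $M_{d-d_j}(g_j\mathbf{y},I_l)\succeq0$ for all $l\in[p]$, $j\in J_l$, and $y_{\mathbf{0}}=1$. Term sparsity. Let $\mathscr{A}=\mathrm{supp}(f)\cup\bigcup_{j=1}^m\mathrm{supp}(g_j)$ and $\mathscr{A}_l=\{\boldsymbol\alpha\in\mathscr{A}:\mathrm{supp}(\boldsymbol\alpha)\subseteq I_l\}$. Let $V_{d,l,j}=\mathbb{N}^{n_l}_{d-d_j}$ for $j\in\{0\}\cup J_l$. $G_{d,l,0}^{(0)}$ is the graph on $V_{d,l,0}$ with edges $\{\boldsymbol\beta,\boldsymbol\gamma\}$, $\boldsymbol\beta\neq\boldsymbol\gamma$, $\boldsymbol\beta+\boldsymbol\gamma\in\mathscr{A}_l\cup(2\mathbb{N})^n$; for $j\in J_l$, $G_{d,l,j}^{(0)}$ is the edgeless graph on $V_{d,l,j}$. For $k\ge0$ set $\mathscr{C}_d^{(k)}=\bigcup_{l=1}^p\bigcup_{j\in\{0\}\cup J_l}(\mathrm{supp}(g_j)+\mathrm{supp}(G_{d,l,j}^{(k)}))$. For $k\ge1$, $F_{d,l,j}^{(k)}$ is the graph on $V_{d,l,j}$ with edges $\{\boldsymbol\beta,\boldsymbol\gamma\}$, $\boldsymbol\beta\ne\boldsymbol\gamma$, such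 that $(\boldsymbol\beta+\boldsymbol\gamma+\mathrm{supp}(g_j))\cap\mathscr{C}_d^{(k-1)}\neq\emptyset$, and $G_{d,l,j}^{(k)}=(F_{d,l,j}^{(k)})'$. The CS-TSSOS relaxation $(\mathrm{Q}^{\mathrm{cs\text{-}ts}}_{d,k})$ is: $\rho_d^{(k)}=\inf L_{\mathbf{y}}(f)$ s.t. $B_{G_{d,l,j}^{(k)}}\circ M_{d-d_j}(g_j\mathbf{y},I_l)\in\Pi_{G_{d,l,j}^{(k)}}(\mathbf{S}_+^{r_{l,j}})$ for all $l\in[p]$, $j\in\{0\}\cup J_l$, and $y_{\mathbf{0}}=1$, where $r_{l,j}=\binom{n_l+d-d_j}{d-d_j}$. Optimal values are in $[-\infty,+\infty]$. *)

(* Defs.v *)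
(* mpoly cannot be imported together with constructive_ereal (incompatible
   notation levels), hence the qualified names ereal.ereal_inf and
   constructive_ereal.EFin below. *)
From HB Require Import structures.
From mathcomp Require Import all_boot all_order all_algebra finmap mpoly.
From mathcomp Require Import classical_sets reals.
From mathcomp Require constructive_ereal ereal.

Set Implicit Arguments.
Unset Strict Implicit.
Unset Printing Implicit Defensive.

Import GRing.Theory Num.Theory.

Local Open Scope ring_scope.

Section Graphs.
Variable T : finType.

(* The node set is the whole type T. *)
Record sgraph := SGraph {
  adj : rel T;
  adj_sym : ssrbool.symmetric adj;
  adj_irr : irreflexive adj }.

Section GraphOf.
Variables (r : rel T) (r_sym : ssrbool.symmetric r).

Fact graph_of_sym : ssrbool.symmetric (fun x y => (x != y) && r x y).
Proof. by move=> x y; rewrite eq_sym r_sym. Qed.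

Fact graph_of_irr : irreflexive (fun x y => (x != y) && r x y).
Proof. by move=> x; rewrite eqxx. Qed.

Definition graph_of : sgraph := SGraph graph_of_sym graph_of_irr.
End GraphOf.

Definition edgeless : sgraph :=
  @graph_of (fun _ _ => false) (fun _ _ => erefl).

Definition subgraph (G H : sgraph) : Prop :=
  forall x y, adj G x y -> adj H x y.

(* Every cycle of length at least 4 has a chord, i.e. an edge joining two
   nodes that are not consecutive on the cycle. *)
Definition chordal (G : sgraph) : Prop :=
  forall c : seq T, ucycle (adj G) c -> (4 <= size c)%N ->
  exists x y, [/\ x \in c, y \in c, adj G x y, next c x != y & next c y != x].

Definition chordal_extension (G H : sgraph) : Prop :=
  subgraph G H /\ chordal H.

Definition max_chordal_ext (G : sgraph) : sgraph :=
  graph_of (sym_connect_sym (@adj_sym G)).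

Definition clique (G : sgraph) (C : {set T}) : bool :=
  [forall x in C, forall y in C, (x != y) ==> adj G x y].

Definition maximal_clique (G : sgraph) (C : {set T}) : bool :=
  maxset (clique G) C.

Definition eq_or_adj (G : sgraph) : rel T := fun x y => (x == y) || adj G x y.

End Graphs.

Arguments edgeless {T}.
Arguments max_chordal_ext {T} G.

Lemma max_chordal_extP (T : finType) (G : sgraph T) :
  chordal_extension G (max_chordal_ext G).
Proof.
split=> [x y xy | c /andP[cc Uc] c4] /=.
  rewrite (connect1 xy) andbT; apply/eqP => exy.
  by rewrite exy adj_irr in xy.
case: c cc Uc c4 => [|x0 [|x1 [|x2 [|x3 c]]]] //= /and4P[].
move=> /andP[_ c01] /andP[_ c12] _ _.
rewrite !inE !negb_or => /and4P[/and4P[n01 n02 n03 _] /and3P[n12 n13 _]].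
move=> /andP[n23 _] _ _.
exists x0, x2; rewrite !inE !eqxx !orbT n02 /=.
rewrite (connect_trans c01 c12) ![x2 == _]eq_sym (negPf n02) (negPf n12).
by split=> //; rewrite eq_sym.
Qed.

Section GraphMatrices.
Variables (R : realType) (T : finType).

(* Matrices indexed by T: rows and columns are numbered by enum_val. *)
Definition mx_of (F : T -> T -> R) : 'M[R]_#|T| :=
  \matrix_(i, j) F (enum_val i) (enum_val j).

Definition psd r (Q : 'M[R]_r) : Prop :=
  Q^T = Q /\ forall v : 'cV[R]_r, 0 <= (v^T *m Q *m v) 0 0.

Definition hadamard r (A B : 'M[R]_r) : 'M[R]_r := map2_mx *%R A B.

Definition adjmx (G : sgraph T) : 'M[R]_#|T| :=
  mx_of (fun x y => (eq_or_adj G x y)%:R).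

Definition Pi (G : sgraph T) (Q : 'M[R]_#|T|) : 'M[R]_#|T| :=
  \matrix_(i, j)
    (if eq_or_adj G (enum_val i) (enum_val j) then Q i j else 0).

End GraphMatrices.

Section Polynomials.
Variables (R : realType) (n : nat).
Implicit Types (h : {mpoly R[n]}) (a : 'X_{1..n}) (S : {set 'I_n}).

Definition mon_supp a : {set 'I_n} := [set i | a i != 0%N].

Definition psupp h : {fset 'X_{1..n}} := [fset a in msupp h]%fset.

Definition vars h : {set 'I_n} := \bigcup_(a <- msupp h) mon_supp a.

Definition even_mon a : bool := [forall i, ~~ odd (a i)].

Lemma even_monP a : reflect (exists b : 'X_{1..n}, a = (b *+ 2)%MM) (even_mon a).
Proof.
apply: (iffP forallP) => [ev | [b ->] i]; last first.
  by rewrite mulmnE muln2 odd_double.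
exists [multinom (a i)./2 | i < n]; apply/mnmP => i.
by rewrite mulmnE mnmE muln2 halfK (negPf (ev i)) subn0.
Qed.

(* half_deg h = ceil(deg h / 2), with deg 0 = 0. *)
Definition half_deg h : nat := uphalf (msize h).-1.

Definition minkowski (A B : {fset 'X_{1..n}}) : {fset 'X_{1..n}} :=
  [fset (a + b)%MM | a in A, b in B]%fset.

(* Exponents of degree at most b supported in S, i.e. N^|S|_b. *)
Definition exps S (b : nat) : {fset 'X_{1..n}} :=
  [fset bmnm a | a in [set a : 'X_{1..n < b.+1} | mon_supp a \subset S]]%fset.

Lemma in_exps S b a :
  (a \in exps S b) = (mdeg a <= b)%N && (mon_supp a \subset S).
Proof.
apply/imfsetP/andP => [[/= c] | [ab aS]].
  by rewrite inE => cS ->; split=> //; rewrite -ltnS bmdeg.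
by exists (@BMultinom n b.+1 a ab); rewrite /= ?inE.
Qed.

Definition gsupp (V : {fset 'X_{1..n}}) (G : sgraph V) : {fset 'X_{1..n}} :=
  [fset (val e.1 + val e.2)%MM
  | e in [set e : V * V | eq_or_adj G e.1 e.2]]%fset.

Definition Lfun (y : 'X_{1..n} -> R) h : R := \sum_(a <- msupp h) h@_a * y a.

Definition moment_mx (V : {fset 'X_{1..n}}) (y : 'X_{1..n} -> R) h :
  'M[R]_#|{: V}| :=
  mx_of (fun b c : V => Lfun y (h * 'X_[val b] * 'X_[val c])).

End Polynomials.

Section CorrelativeSparsity.
Variables (R : realType) (n m p : nat).
Variables (f : {mpoly R[n]}) (g : 'I_m -> {mpoly R[n]}).

Definition d_min : nat :=
  maxn (half_deg f) (\max_(j < m) half_deg (g j)).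

Definition csp_rel : rel 'I_n := fun i j =>
  has (fun a : 'X_{1..n} => (0 < a i)%N && (0 < a j)%N) (msupp f)
  || [exists k, (i \in vars (g k)) && (j \in vars (g k))].

Fact csp_rel_sym : ssrbool.symmetric csp_rel.
Proof.
move=> i j; congr (_ || _); first by apply: eq_has => a; rewrite andbC.
by apply: eq_existsb => k; rewrite andbC.
Qed.

Definition csp_graph : sgraph 'I_n := graph_of csp_rel_sym.

(* I lists, without repetition, the maximal cliques of H. *)
Definition lists_maximal_cliques (H : sgraph 'I_n) (I : 'I_p -> {set 'I_n}) :=
  injective I /\ forall C, maximal_clique H C <-> exists l, I l = C.

Definition constraint_assignment
    (I : 'I_p -> {set 'I_n}) (J : 'I_p -> {set 'I_m}) : Prop :=
  [/\ forall l l', l != l' -> [disjoint J l & J l'],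
      \bigcup_l J l = [set: 'I_m]
    & forall l j, j \in J l -> vars (g j) \subset I l].

Variables (I : 'I_p -> {set 'I_n}) (J : 'I_p -> {set 'I_m}) (d : nat).

Definition cs_feasible (y : 'X_{1..n} -> R) : Prop :=
  [/\ forall l, psd (moment_mx (exps (I l) d) y 1),
      forall l j, j \in J l ->
        psd (moment_mx (exps (I l) (d - half_deg (g j))) y (g j))
    & y 0%MM = 1].

Definition rho_cs : constructive_ereal.extended R :=
  ereal.ereal_inf
    [set constructive_ereal.EFin (Lfun y f) | y in cs_feasible]%classic.

(* The index set {0} \cup [m] is option 'I_m, with None standing for 0; as
   half_deg 1 = 0, this covers d_0 = 0. *)
Definition g0 (j : option 'I_m) : {mpoly R[n]} := if j is Some j' then g j' else 1.

Definition J0 (l : 'I_p) : {set option 'I_m} := None |: [set Some j | j in J l].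

Definition V (l : 'I_p) (j : option 'I_m) : {fset 'X_{1..n}} :=
  exps (I l) (d - half_deg (g0 j)).

Definition all_supp : {fset 'X_{1..n}} :=
  (psupp f `|` \bigcup_(j in 'I_m) psupp (g j))%fset.

Definition clique_supp (l : 'I_p) : {fset 'X_{1..n}} :=
  [fset a in all_supp | mon_supp a \subset I l]%fset.

Section InitialGraph.
Variable l : 'I_p.

Definition init_rel : rel (V l None) := fun b c =>
  let a := (val b + val c)%MM in (a \in clique_supp l) || even_mon a.

Fact init_rel_sym : ssrbool.symmetric init_rel.
Proof. by move=> b c; rewrite /init_rel addmC. Qed.

Definition init_graph (j : option 'I_m) : sgraph (V l j) :=
  if j is None then graph_of init_rel_sym else edgeless.
End InitialGraph.

Definition graph_family := forall (l : 'I_p) (j : option 'I_m), sgraph (V l j).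

Definition support_of (G : graph_family) : {fset 'X_{1..n}} :=
  (\bigcup_(l in 'I_p) \bigcup_(j in J0 l)
     minkowski (psupp (g0 j)) (gsupp (G l j)))%fset.

Section SupportExtension.
Variables (C : {fset 'X_{1..n}}) (l : 'I_p) (j : option 'I_m).

Definition F_rel : rel (V l j) := fun b c =>
  (minkowski [fset (val b + val c)%MM] (psupp (g0 j)) `&` C != fset0)%fset.

Fact F_rel_sym : ssrbool.symmetric F_rel.
Proof. by move=> b c; rewrite /F_rel addmC. Qed.

Definition F_graph : sgraph (V l j) := graph_of F_rel_sym.
End SupportExtension.

(* ext maps a graph G to its chosen chordal extension G'. *)
Variable ext : forall T : finType, sgraph T -> sgraph T.

Fixpoint ts_graph (k : nat) : graph_family := fun l j =>
  match k with
  | 0 => init_graph l j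
  | k'.+1 => ext (F_graph (support_of (ts_graph k')) l j)
  end.

Definition cs_ts_feasible (k : nat) (y : 'X_{1..n} -> R) : Prop :=
  (forall l j, j \in J0 l ->
     exists2 Q : 'M[R]_#|{: V l j}|, psd Q &
       hadamard (adjmx R (ts_graph k l j)) (moment_mx (V l j) y (g0 j))
       = Pi (ts_graph k l j) Q)
  /\ y 0%MM = 1.

Definition rho_cs_ts (k : nat) : constructive_ereal.extended R :=
  ereal.ereal_inf
    [set constructive_ereal.EFin (Lfun y f) | y in cs_ts_feasible k]%classic.

End CorrelativeSparsity.

(* Main.v *)
(* The supports C^(k) increase with k inside a finite set, so they stabilise:
   C^(k) = C^(k-1) =: C for large k. Given y feasible for the term-sparse
   relaxation, put y' = y on C and y' = 0 elsewhere. Entries of the moment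
   matrices of y' at edges of G^(k) are those of y, as C contains C^(k); the
   other ones vanish, since a non-edge of G^(k) is a non-edge of F^(k), all of
   whose exponents lie outside C^(k-1) = C. As G^(k) is a disjoint union of
   complete graphs, Pi_G preserves positive semidefiniteness, so y' is feasible
   for the dense relaxation; its objective value is unchanged as supp(f) is
   contained in C. *)
Require Import Defs.
From HB Require Import structures.
From mathcomp Require Import all_boot all_order all_algebra finmap mpoly.
From mathcomp Require Import classical_sets reals.

Set Implicit Arguments.
Unset Strict Implicit.
Unset Printing Implicit Defensive.

Import GRing.Theory Num.Theory.

Local Open Scope ring_scope.

(** * Adjacency in the maximal chordal extension *)

Lemma eq_or_adj_graph_of (T : finType) (r : rel T) (rS : ssrbool.symmetric r) x y :
  eq_or_adj (graph_of rS) x y = (x == y) || r x y.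
Proof. by rewrite /eq_or_adj /=; case: eqP. Qed.

(** The root is a canonical label of a connected component; these labels index the diagonal blocks
    of a matrix restricted to the extension. *)
Lemma eq_or_adj_max_chordal_ext (T : finType) (G : sgraph T) x y :
  eq_or_adj (max_chordal_ext G) x y = (fingraph.root (adj G) x == fingraph.root (adj G) y).
Proof.
rewrite eq_or_adj_graph_of (fingraph.root_connect (sym_connect_sym (@adj_sym _ G))).
by case: eqP => // ->; rewrite connect0.
Qed.

Lemma eq_or_adj_max_chordal_ext_mono (T : finType) (G1 G2 : sgraph T) x y :
  subgraph G1 G2 ->
  eq_or_adj (max_chordal_ext G1) x y -> eq_or_adj (max_chordal_ext G2) x y.
Proof.
move=> sub; rewrite !eq_or_adj_graph_of => /orP[-> // | xy].
by apply/orP; right; apply: connect_sub xy => a b /sub /connect1.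
Qed.

Lemma eq_or_adj_max_chordal_ext_sub (T : finType) (G : sgraph T) x y :
  eq_or_adj G x y -> eq_or_adj (max_chordal_ext G) x y.
Proof.
by rewrite eq_or_adj_graph_of => /orP[-> // | /connect1 ->]; rewrite orbT.
Qed.

(** * Quadratic forms and restriction of matrices to graph patterns *)

Section Matrices.
Variables (R : realType) (T : finType).

Lemma quadratic_formE r (Q : 'M[R]_r) (v : 'cV[R]_r) :
  (v^T *m Q *m v) 0 0 = \sum_i \sum_j v i 0 * Q i j * v j 0.
Proof.
rewrite mxE exchange_big /=; apply: eq_bigr => j _.
by rewrite mxE big_distrl; apply: eq_bigr => i _; rewrite mxE.
Qed.

Lemma hadamard_adjmx (G : sgraph T) (A : 'M[R]_#|T|) :
  hadamard (adjmx R G) A = Pi G A.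
Proof.
by apply/matrixP => i j; rewrite !mxE; case: ifP; rewrite ?mul1r ?mul0r.
Qed.

Lemma psd_Pi_max_chordal_ext (G : sgraph T) (Q : 'M[R]_#|T|) :
  psd Q -> psd (Pi (max_chordal_ext G) Q).
Proof.
move=> [QT Qge0]; split.
  apply/matrixP => i j; rewrite !mxE !eq_or_adj_max_chordal_ext eq_sym.
  by rewrite -{1}QT mxE.
move=> v; pose rt (i : 'I_#|T|) := fingraph.root (adj G) (enum_val i).
(* The form of the block-diagonal matrix is the sum, over the roots t of the
   components, of the form of Q at the restriction of v to the component. *)
pose w t : 'cV[R]_#|T| := \col_i (if rt i == t then v i 0 else 0).
suff -> : ((v^T *m Pi (max_chordal_ext G) Q *m v) 0 0
           = \sum_t ((w t)^T *m Q *m w t) 0 0) by apply: sumr_ge0.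
rewrite quadratic_formE; under [RHS]eq_bigr do rewrite quadratic_formE.
rewrite [RHS]exchange_big /=; apply: eq_bigr => i _.
rewrite [RHS]exchange_big /=; apply: eq_bigr => j _.
rewrite (bigD1 (rt i)) //= big1 ?addr0 => [|t ti]; last first.
  by rewrite !mxE eq_sym (negPf ti) !mul0r.
rewrite !mxE eqxx eq_or_adj_max_chordal_ext -/(rt i) -/(rt j) eq_sym.
by case: ifP; rewrite ?mulr0 ?mul0r.
Qed.

End Matrices.

(** * Splitting exponents and expanding moment entries *)

Section Multinomials.
Variable n : nat.
Implicit Types a b c : 'X_{1..n}.

Lemma ex_submultinomial a e :
  (e <= mdeg a)%N -> exists2 b, (b <= a)%MM & mdeg b = e.
Proof.
elim: e => [|e IHe] ea; first by exists 0%MM; [apply/mnm_lepP => i; rewrite mnm0E | exact: mdeg0].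
have [b ba be] := IHe (ltnW ea).
have [i bi] : exists i, (b i < a i)%N.
  apply/existsP; apply: contraLR ea => /existsPn ab.
  rewrite -leqNgt -be !mdegE; apply: leq_sum => i _.
  by rewrite leqNgt ab.
exists (b + U_(i))%MM; last by rewrite mdegD mdeg1 be addn1.
apply/mnm_lepP => k; rewrite mnmDE mnm1E.
by case: eqP => [<-|_]; rewrite ?addn1 ?addn0 //; move/mnm_lepP: ba.
Qed.

Lemma mon_supp_lepm a b : (a <= b)%MM -> mon_supp a \subset mon_supp b.
Proof.
move=> /mnm_lepP ab; apply/fintype.subsetP => i; rewrite !inE -!lt0n => ai.
exact: leq_trans ai (ab i).
Qed.

(** Take [b] below [a] of degree [minn d (mdeg a)]; the remainder [a - b] then has degree at most
    [d], and both supports lie in that of [a]. *)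
Lemma exps_split (S : {set 'I_n}) d a :
  (mdeg a <= d.*2)%N -> mon_supp a \subset S ->
  exists b c, [/\ b \in exps S d, c \in exps S d & a = (b + c)%MM].
Proof.
move=> ad aS; have [b ba be] := ex_submultinomial (geq_minr d (mdeg a)).
have abK : a = (b + (a - b))%MM by rewrite addmC submK.
exists b, (a - b)%MM; rewrite !in_exps be geq_minl /=.
split=> //; first exact: fintype.subset_trans (mon_supp_lepm ba) aS.
rewrite (fintype.subset_trans (mon_supp_lepm (lem_subr _ _)) aS) andbT.
have := congr1 (@mdeg n) abK; rewrite mdegD be => da.
rewrite -(leq_add2l (minn d (mdeg a))) -da.
by case: (leqP d (mdeg a)); rewrite ?addnn ?leq_addr.
Qed.

Lemma mdeg_half_deg (R : realType) (h : {mpoly R[n]}) d a :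
  (half_deg h <= d)%N -> a \in msupp h -> (mdeg a <= d.*2)%N.
Proof.
(* [msize] is the degree plus one, and [ah] rules out [msize h = 0], where the predecessor would not
   undo this shift. *)
rewrite /half_deg => hd /msize_mdeg_lt ah; move: hd; rewrite leq_uphalf_double.
by apply: leq_trans; case: (msize h) ah.
Qed.

Lemma LfunMXX (R : realType) (y : 'X_{1..n} -> R) h b c :
  Lfun y (h * 'X_[b] * 'X_[c]) = \sum_(a <- msupp h) h@_a * y (a + (b + c))%MM.
Proof.
rewrite -mulrA -mpolyXD /Lfun (perm_big _ (msuppMX _ _)) big_map /=.
by apply: eq_bigr => a _; rewrite mcoeffMX [X in y X]addmC.
Qed.

Lemma eq_Lfun (R : realType) (y z : 'X_{1..n} -> R) h :
  {in msupp h, y =1 z} -> Lfun y h = Lfun z h.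
Proof. by move=> yz; apply: eq_big_seq => a /yz ->. Qed.

Lemma minkowskiP (A B : {fset 'X_{1..n}}) a :
  reflect (exists b c, [/\ b \in A, c \in B & a = (b + c)%MM])
          (a \in minkowski A B).
Proof.
apply: (iffP (imfset2P _ _ _ _ _)) => [[b /= bA [c cB ->]] | [b [c [bA cB ->]]]].
  by exists b, c.
by exists b => //; exists c.
Qed.

End Multinomials.

(** One repetition suffices, since every later term is obtained by the same map. Without a
    repetition in the first [#|U|.+1] steps, each step would add an element, exceeding the size of
    [U]. *)
Lemma fset_iter_stable (K : choiceType) (phi : {fset K} -> {fset K}) U C :
  (forall k, iter k phi C `<=` iter k.+1 phi C)%fset ->
  (forall k, iter k phi C `<=` U)%fset ->
  exists k0, forall k, (k0 <= k)%N -> iter k.+1 phi C = iter k phi C.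
Proof.
move=> inc bnd.
suff [k0 k0P] : exists k0, iter k0.+1 phi C = iter k0 phi C.
  exists k0 => k /subnK <-; elim: (k - k0)%N => //= i IHi.
  by rewrite !IHi.
have [/existsP[k /eqP kP] | /existsPn stable] :=
  boolP [exists k : 'I_(#|` U|).+1, iter k.+1 phi C == iter k phi C].
  by exists k.
suff le_card k : (k <= #|` U|.+1)%N -> (k <= #|` iter k phi C|)%N.
  have := leq_trans (le_card _ (leqnn _)) (fsubset_leq_card (bnd _)).
  by rewrite ltnn.
elim: k => // k IHk kU; apply: leq_ltn_trans (IHk (ltnW kU)) _.
apply: fproper_ltn_card; rewrite fproperEneq inc andbT eq_sym.
exact: (stable (Ordinal kU)).
Qed.

(** * The supports C^(k) and their stabilisation *)

Section Relaxations.
Variables (R : realType) (n m p : nat).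
Variables (f : {mpoly R[n]}) (g : 'I_m -> {mpoly R[n]}).
Variables (I : 'I_p -> {set 'I_n}) (J : 'I_p -> {set 'I_m}) (d : nat).

Local Notation graphs := (graph_family g I d).

Lemma in_support_of (G : graphs) a :
  reflect (exists l j (b c : V g I d l j) e,
             [/\ j \in J0 J l, e \in msupp (g0 g j), eq_or_adj (G l j) b c
               & a = (e + (val b + val c))%MM])
          (a \in support_of J G).
Proof.
apply: (iffP (bigfcupP _ _ _ _)) => [[l _ /bigfcupP[j]] | ].
  move=> /andP[_ jJ] /minkowskiP[e [s [+ + ->]]].
  rewrite !inE => eg /imfsetP[[b c] /=]; rewrite inE /= => bc ->.
  by exists l, j, b, c, e.
move=> [l [j [b [c [e [jJ eg bc ->]]]]]]; exists l.
  by rewrite mem_index_enum.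
apply/bigfcupP; exists j; first by rewrite mem_index_enum.
apply/minkowskiP; exists e, (val b + val c)%MM; split=> //.
  by rewrite !inE.
by apply/imfsetP; exists (b, c); rewrite /= ?inE.
Qed.

Lemma support_of_mono (G1 G2 : graphs) :
  (forall l j, j \in J0 J l ->
     forall b c, eq_or_adj (G1 l j) b c -> eq_or_adj (G2 l j) b c) ->
  (support_of J G1 `<=` support_of J G2)%fset.
Proof.
move=> sub; apply/fsubsetP => a /in_support_of[l [j [b [c [e [jJ eg bc ->]]]]]].
by apply/in_support_of; exists l, j, b, c, e; split=> //; apply: sub.
Qed.

Lemma F_relP C l j (b c : V g I d l j) :
  reflect (exists2 e, e \in msupp (g0 g j) & (e + (val b + val c))%MM \in C)
          (F_rel C b c).
Proof.
apply: (iffP (fset0Pn _)) => [[a] | [e eg eC]].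
  rewrite inE => /andP[/minkowskiP[s [e [+ + ->]]]].
  by rewrite !inE => /eqP-> eg; rewrite addmC; exists e.
exists (e + (val b + val c))%MM; rewrite inE eC andbT.
by apply/minkowskiP; exists (val b + val c)%MM, e; split; rewrite ?inE 1?addmC.
Qed.

(** The graphs of one step depend on the previous ones only through their support, so the supports
    form an orbit of the single map [next_support]. *)
Definition next_graph (C : {fset 'X_{1..n}}) : graphs :=
  fun l j => max_chordal_ext (F_graph g I d C l j).

Definition next_support (C : {fset 'X_{1..n}}) := support_of J (next_graph C).

Definition ts_support k := support_of J (ts_graph f g I J d (@max_chordal_ext) k).

Lemma ts_supportS k : ts_support k.+1 = next_support (ts_support k).
Proof. reflexivity. Qed.

Lemma ts_supportE k : ts_support k = iter k next_support (ts_support 0).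
Proof. by elim: k => [|k IHk]; rewrite ?iterS -?IHk. Qed.

(** A larger [C] gives more edges in [F_graph], and completing components is monotone in the graph;
    an arbitrary choice of chordal extensions need not be. *)
Lemma next_support_mono C1 C2 :
  (C1 `<=` C2)%fset -> (next_support C1 `<=` next_support C2)%fset.
Proof.
move=> /fsubsetP sub; apply: support_of_mono => l j _ b c.
apply: eq_or_adj_max_chordal_ext_mono => x y /andP[xy /F_relP[e eg eC]] /=.
by rewrite xy; apply/F_relP; exists e => //; apply: sub.
Qed.

(** Constraint blocks start with the diagonal only. In the block [None] the polynomial is 1, with
    sole exponent 0, so the sum of two adjacent nodes is itself in the initial support. *)
Lemma ts_support0_sub : (ts_support 0 `<=` next_support (ts_support 0))%fset.
Proof.
apply: support_of_mono => l [j|] jJ b c bc.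
  move: bc; rewrite eq_or_adj_graph_of orbF => /eqP ->.
  by rewrite /eq_or_adj eqxx.
apply: eq_or_adj_max_chordal_ext_sub.
rewrite eq_or_adj_graph_of; apply/orP; right.
apply/F_relP; exists 0%MM; first by rewrite /= msupp1 inE.
apply/in_support_of; exists l, None, b, c, 0%MM; split=> //.
by rewrite /= msupp1 inE.
Qed.

Lemma ts_support_inc k : (ts_support k `<=` ts_support k.+1)%fset.
Proof.
elim: k => [|k IHk]; first exact: ts_support0_sub.
exact: next_support_mono.
Qed.

Lemma ts_support0_le k : (ts_support 0 `<=` ts_support k)%fset.
Proof.
by elim: k => // k IHk; apply: fsubset_trans IHk (ts_support_inc k).
Qed.

Lemma ts_support_stable :
  exists k0, forall k, (k0 <= k)%N -> ts_support k.+1 = ts_support k.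
Proof.
(* Complete graphs on all blocks give a finite set bounding every support. *)
pose full : graphs := fun l j =>
  @graph_of (V g I d l j) (fun _ _ => true) (fun _ _ => erefl).
have := @fset_iter_stable _ next_support (support_of J full) (ts_support 0).
case=> [k|k|k0 k0P]; rewrite -?ts_supportE.
- exact: ts_support_inc.
- by apply: support_of_mono => l j _ b c _; rewrite eq_or_adj_graph_of orbT.
by exists k0 => k /k0P; rewrite -!ts_supportE.
Qed.

(** * Comparison of the feasible sets *)

Lemma J0_None l : None \in J0 J l.
Proof. by rewrite !inE. Qed.

Lemma J0_Some l j : (Some j \in J0 J l) = (j \in J l).
Proof. by rewrite !inE /= mem_imset // => ? ? []. Qed.

Lemma V_None l : V g I d l None = exps (I l) d.
Proof. by rewrite /V /half_deg msize1 subn0. Qed.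

Lemma cs_feasibleP y :
  cs_feasible g I J d y <->
  (forall l j, j \in J0 J l -> psd (moment_mx (V g I d l j) y (g0 g j)))
  /\ y 0%MM = 1.
Proof.
split=> [[M0 M1 y0] | [M y0]]; split=> //.
- by move=> l [j|]; rewrite ?J0_Some => jJ; [apply: M1 | rewrite V_None; apply: M0].
- by move=> l; have := M l None (J0_None l); rewrite V_None.
- by move=> l j jJ; apply: (M l (Some j)); rewrite J0_Some.
Qed.

(** The moment matrix itself serves as the PSD completion [Q]. *)
Lemma cs_feasible_cs_ts ext k y :
  cs_feasible g I J d y -> cs_ts_feasible f g I J d ext k y.
Proof.
move=> /cs_feasibleP[M y0]; split=> // l j jJ.
by exists (moment_mx (V g I d l j) y (g0 g j)); [apply: M | apply: hadamard_adjmx].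
Qed.

Definition truncate (C : {fset 'X_{1..n}}) (y : 'X_{1..n} -> R) a : R :=
  if a \in C then y a else 0.

Lemma moment_mx_truncate C y l j :
  next_support C = C -> j \in J0 J l ->
  moment_mx (V g I d l j) (truncate C y) (g0 g j)
  = Pi (next_graph C l j) (moment_mx (V g I d l j) y (g0 g j)).
Proof.
move=> CP jJ; apply/matrixP => s t; rewrite !mxE !LfunMXX.
move: (enum_val s) (enum_val t) => b c; case: ifP => [bc | /negP nbc].
  (* The fixed-point equation puts every exponent of an edge entry in [C]. *)
  apply: eq_big_seq => e eg; rewrite /truncate ifT // -CP.
  by apply/in_support_of; exists l, j, b, c, e.
rewrite big_seq big1 // => e eg; rewrite /truncate ifF ?mulr0 //.
apply/negP => eC; apply: nbc; apply: eq_or_adj_max_chordal_ext_sub.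
by rewrite eq_or_adj_graph_of; apply/orP; right; apply/F_relP; exists e.
Qed.

(** The graphs at step [k.+1] are [next_graph] of the support at step [k], hence the shift between
    feasibility and truncation. Membership of 0 preserves the normalisation. *)
Lemma cs_feasible_truncate k y :
  ts_support k.+1 = ts_support k -> 0%MM \in ts_support 0 ->
  cs_ts_feasible f g I J d (@max_chordal_ext) k.+1 y ->
  cs_feasible g I J d (truncate (ts_support k) y).
Proof.
move=> kP C0 [M y0]; apply/cs_feasibleP; split=> [l j jJ|]; last first.
  by rewrite /truncate (fsubsetP (ts_support0_le k)).
have [Q Qpsd] := M l j jJ; rewrite moment_mx_truncate // hadamard_adjmx.
by move=> ->; apply: psd_Pi_max_chordal_ext.
Qed.

Lemma exps_in_ts_support0 l a :
  (mdeg a <= d.*2)%N -> mon_supp a \subset I l ->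
  a \in psupp f \/ a = 0%MM -> a \in ts_support 0.
Proof.
move=> ad aI af; have [b [c [bV cV abc]]] := exps_split ad aI.
rewrite -V_None in bV cV; apply/in_support_of.
exists l, None, [` bV]%fset, [` cV]%fset, 0%MM; split.
- exact: J0_None.
- by rewrite /= msupp1 inE.
- rewrite eq_or_adj_graph_of; apply/orP; right; rewrite /init_rel /= -abc.
  case: af => [af | ->].
    by move: af; rewrite !inE => ->; rewrite aI.
  by apply/orP; right; apply/forallP => i; rewrite mnm0E.
- by rewrite add0m.
Qed.

End Relaxations.

(** * Locating exponents in cliques, and the convergence *)

Lemma clique_sub_listed n p (H : sgraph 'I_n) (I : 'I_p -> {set 'I_n}) C :
  lists_maximal_cliques H I -> clique H C -> exists l, C \subset I l.
Proof.
move=> [_ hI] /maxset_exists[M /hI[l <-] CM].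
by exists l.
Qed.

Lemma clique_mon_supp (R : realType) n m (f : {mpoly R[n]})
    (g : 'I_m -> {mpoly R[n]}) H a :
  subgraph (csp_graph f g) H -> a \in msupp f -> clique H (mon_supp a).
Proof.
move=> sub af; apply/forall_inP => i ai; apply/forall_inP => j aj.
apply/implyP => ij; apply: sub; rewrite /= ij; apply/orP; left.
by apply/hasP; exists a => //; move: ai aj; rewrite !inE !lt0n => -> ->.
Qed.

Theorem theorem4p1 (R : realType) (n m p : nat)
    (f : {mpoly R[n]}) (g : 'I_m -> {mpoly R[n]})
    (H : sgraph 'I_n) (I : 'I_p -> {set 'I_n}) (J : 'I_p -> {set 'I_m})
    (d : nat)
    (hH : chordal_extension (csp_graph f g) H)
    (hI : lists_maximal_cliques H I)
    (hJ : constraint_assignment g I J)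
    (hd : (d_min f g <= d)%N) :
  exists k0 : nat, (1 <= k0)%N /\
    forall k : nat, (k0 <= k)%N ->
      rho_cs_ts f g I J d (@max_chordal_ext) k = rho_cs f g I J d.
Proof.
have C0 : 0%MM \in ts_support f g I J d 0.
  (* The empty clique extends to a maximal one, so at least one block exists. *)
  have [|l _] := clique_sub_listed (C := finset.set0) hI.
    by apply/forall_inP => i; rewrite inE.
  apply: (exps_in_ts_support0 _ _ _ (l := l)); last by right.
    by rewrite mdeg0.
  by apply/fintype.subsetP => i; rewrite inE mnm0E.
have Cf a : a \in msupp f -> a \in ts_support f g I J d 0.
  move=> af; have [l aI] := clique_sub_listed hI (clique_mon_supp hH.1 af).
  apply: (exps_in_ts_support0 _ _ _ (l := l)) => //; last by left; rewrite !inE.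
  by apply: mdeg_half_deg af; apply: leq_trans hd; apply: leq_maxl.
have [k0 k0P] := ts_support_stable f g I J d.
(* The shift by one leaves out the initial graphs, which are not built by [max_chordal_ext]. *)
exists k0.+1; split=> // -[//|k] /k0P kP.
rewrite /rho_cs_ts /rho_cs; congr (ereal.ereal_inf _).
(* The two infima range over the same set of objective values. *)
apply/seteqP; split=> _ [y yP <-]; last first.
  by exists y => //; apply: cs_feasible_cs_ts.
exists (truncate (ts_support f g I J d k) y).
  exact: cs_feasible_truncate.
congr constructive_ereal.EFin; apply: eq_Lfun => a /Cf aC.
by rewrite /truncate (fsubsetP (ts_support0_le _ _ _ _ _ k)).
Qed.
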